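(* Let $\Bbbk$ be a field of characteristic $2$. Then the discriminant $\mathcal{D}(d)$ of the universal binary form of degree $d$ is a square of a homogeneous polynomial of degree $d-1$ (in the coefficients of the form).
   Context: A universal binary form of degree $d$ is a homogeneous polynomial $\sum_{i=0}^d a_i s^{d-i}t^i$ of degree $d$ in two variables whose coefficients $a_0,\ldots,a_d$ are algebraically independent over the base field. Its discriminant is a homogeneous polynomial of degree $2(d-1)$ in $a_0,\ldots,a_d$. *)

(* Defs.v *)
From HB Require Import structures.
From mathcomp Require Import all_boot all_order all_algebra.
From mathcomp Require Import zify.
From mathcomp Require Export mpoly.

Set Implicit Arguments.
Unset Strict Implicit.
Unset Printing Implicit Defensive.

Import Order.TTheory GRing.Theory Num.Theory.
Local Open Scope ring_scope.

(* The monomial s^(d-i) t^i, with s = 'X_0 and t = 'X_1. *)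
Definition binary_mnm (d i : nat) : 'X_{1..2} :=
  (U_(ord0) *+ (d - i) + U_(ord_max) *+ i)%MM.

(* The coefficients a_i are the variables 'X_i of {mpoly R[d.+1]}. *)
Definition universal_form (R : comNzRingType) (d : nat) :
    {mpoly {mpoly R[d.+1]}[2]} :=
  \sum_(i < d.+1) ('X_i : {mpoly R[d.+1]}) *: 'X_[binary_mnm d i].

(* F(s,t) |-> F('X, 1) *)
Definition dehomogenize (A : comNzRingType) (F : {mpoly A[2]}) : {poly A} :=
  mmap (@polyC A) (fun j : 'I_2 => if j == ord0 then 'X else 1) F.

(* The quotient of p by the variable 'X_0, exact when 'X_0 divides p. *)
Definition divX0 (R : nzRingType) (n : nat) (p : {mpoly R[n.+1]}) :
    {mpoly R[n.+1]} :=
  \sum_(m <- msupp p | (0 < m ord0)%N) p@_m *: 'X_[m - U_(ord0)].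

(* The integral discriminant (-1)^(d(d-1)/2) a_0^-1 Res(f, f') of
   f = a_0 x^d + ... + a_d over Z; see discrZE for the exactness of the
   division when 0 < d. The resultant must be taken over Z and not over a field
   of positive characteristic, where f' may drop degree. *)
Definition discrZ (d : nat) : {mpoly int[d.+1]} :=
  let f := dehomogenize (universal_form int d) in
  divX0 ((-1) ^+ 'C(d, 2) * resultant f f^`()).

(* The discriminant of a binary form F of degree d over any commutative ring:
   the integral discriminant evaluated at the coefficients of F. *)
Definition discriminant (A : comNzRingType) (d : nat) (F : {mpoly A[2]}) : A :=
  mmap (intr : int -> A) (fun i : 'I_d.+1 => F@_(binary_mnm d i)) (discrZ d).

Lemma divX0K (R : comNzRingType) (n : nat) (p : {mpoly R[n.+1]}) :
  divX0 ('X_ord0 * p) = p.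
Proof.
have suppP : forall m, m \in msupp ('X_ord0 * p) -> (0 < m ord0)%N.
  move=> m; rewrite mulrC (perm_mem (msuppMX p U_(ord0))).
  by case/mapP=> m' _ ->; rewrite mnmDE mnm1E eqxx.
rewrite /divX0 big_seq_cond (eq_bigl (fun m => m \in msupp ('X_ord0 * p)));
  last by move=> m /=; case: (boolP (m \in _)) => //= /suppP ->.
rewrite -big_seq mulrC (perm_big _ (msuppMX p U_(ord0))) /= big_map.
rewrite [RHS]mpolyE; apply: eq_bigr => m _.
by congr (_ *: 'X_[_]); [exact: mcoeffMX | rewrite addmC addmK].
Qed.

Lemma dehomogenize_universal (R : comNzRingType) (d : nat) :
  dehomogenize (universal_form R d) =
  \sum_(i < d.+1) ('X_i : {mpoly R[d.+1]}) *: 'X^(d - i).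
Proof.
rewrite /dehomogenize /universal_form raddf_sum /=; apply: eq_bigr => i _.
rewrite mmapZ mmapX /mmap1 big_ord_recl big_ord1 /= !mnmDE !mulmnE !mnm1E /=.
by rewrite expr1n mulr1 mul1n mul0n addn0 -mul_polyC.
Qed.

Lemma resultant_dvd_lead (A : comNzRingType) (c : A) (f g : {poly A}) :
  (1 < size f)%N ->
  (forall n, ((size f).-1 <= n)%N -> exists r, f`_n = c * r) ->
  (forall n, ((size g).-1 <= n)%N -> exists r, g`_n = c * r) ->
  exists r, resultant f g = c * r.
Proof.
move=> sf dvd_f dvd_g.
have dS_gt0 : (0 < (size g).-1 + (size f).-1)%N by rewrite addn_gt0; lia.
have j_lt : (((size g).-1 + (size f).-1).-1 < (size g).-1 + (size f).-1)%N
  by lia.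
pose j := Ordinal j_lt.
have aux (a b l : nat) : (l < a)%N -> (b <= (a + b).-1 - l)%N by lia.
have /fin_all_exists[r rE] i : exists r, Sylvester_mx f g i j = c * r.
  rewrite Sylvester_mxE; case: (split i) => l /=; have := ltn_ord l => ll.
    case: leqP => _; last by exists 0; rewrite mulr0.
    by apply: dvd_f; apply: aux.
  case: leqP => _; last by exists 0; rewrite mulr0.
  by apply: dvd_g; rewrite addnC; apply: aux.
exists (\sum_i r i * cofactor (Sylvester_mx f g) i j).
rewrite /resultant (expand_det_col _ j) mulr_sumr; apply: eq_bigr => i _.
by rewrite rE mulrA.
Qed.

Lemma coef_dehomogenize_universal (R : comNzRingType) (d n : nat) :
  (dehomogenize (universal_form R d))`_n =
  if (n <= d)%N then 'X_(inord (d - n)) else 0.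
Proof.
rewrite dehomogenize_universal coef_sum.
under eq_bigr do rewrite coefZ coefXn.
case: leqP => [le_nd | lt_dn].
  rewrite (bigD1 (inord (d - n))) //= inordK ?ltnS ?leq_subr // subKn //.
  rewrite eqxx mulr1 big1 ?addr0 // => i; rewrite -val_eqE /=.
  rewrite inordK ?ltnS ?leq_subr // => neq_i.
  have := ltn_ord i; rewrite ltnS => le_id.
  by case: eqP => [eq_n|]; rewrite ?mulr0 //; move: neq_i; rewrite eq_n subKn ?eqxx.
rewrite big1 // => i _; have -> : (n == d - i)%N = false by lia.
by rewrite mulr0.
Qed.

Lemma discrZE (d : nat) : (0 < d)%N ->
  let f := dehomogenize (universal_form int d) in
  'X_ord0 * discrZ d = (-1) ^+ 'C(d, 2) * resultant f f^`().
Proof.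
move=> d_gt0 f.
have fE n : f`_n = if (n <= d)%N then 'X_(inord (d - n)) else 0.
  exact: coef_dehomogenize_universal.
have X_neq0 (i : 'I_d.+1) : ('X_i : {mpoly int[d.+1]}) != 0.
  by apply/eqP=> /(congr1 (mcoeff U_(i))); rewrite mcoeffXU eqxx mcoeff0.
have fd : f`_d = 'X_ord0.
  by rewrite fE leqnn subnn; congr 'X_(_); apply: val_inj; rewrite /= inordK.
have size_f : size f = d.+1.
  apply/eqP; rewrite eqn_leq; apply/andP; split.
    by apply/leq_sizeP => n lt_dn; rewrite fE leqNgt lt_dn.
  by rewrite ltnNge; apply/negP => /leq_sizeP/(_ d (leqnn _)); apply/eqP; rewrite fd.
have f'd : f^`()`_d.-1 = d%:R * 'X_ord0.
  by rewrite coef_deriv prednK // fd mulr_natl.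
have size_f' : size f^`() = d.
  apply/eqP; rewrite eqn_leq; apply/andP; split.
    apply/leq_sizeP => n le_dn.
    by rewrite coef_deriv fE ltnNge le_dn mul0rn.
  rewrite leqNgt; apply/negP => lt_sz.
  have /leq_sizeP/(_ d.-1 (leqnn _)) : (size f^`() <= d.-1)%N by lia.
  move/eqP; rewrite f'd mulf_eq0 (negPf (X_neq0 _)) orbF => /eqP.
  move/(congr1 (mcoeff 0%MM)); rewrite raddfMn /= mcoeff1 eqxx mcoeff0.
  by move/eqP; rewrite pnatr_eq0; lia.
have dvd_f n : (d <= n)%N -> exists r, f`_n = 'X_ord0 * r.
  rewrite leq_eqVlt => /predU1P[<-|lt_dn]; first by exists 1; rewrite mulr1.
  by exists 0; rewrite mulr0 fE leqNgt lt_dn.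
have [||| r rE] := @resultant_dvd_lead _ ('X_ord0) f f^`().
- by rewrite size_f.
- by rewrite size_f.
- rewrite size_f' => n le_dn; have [|r rE] := dvd_f n.+1; first by lia.
  by exists (r *+ n.+1); rewrite coef_deriv rE mulrnAr.
by rewrite /discrZ -/f rE mulrCA divX0K.
Qed.

Lemma mcoeff_universal (R : comNzRingType) (d : nat) (i : 'I_d.+1) :
  (universal_form R d)@_(binary_mnm d i) = 'X_i.
Proof.
rewrite /universal_form raddf_sum /= (bigD1 i) //= mcoeffZ mcoeffX eqxx mulr1.
rewrite big1 ?addr0 // => j /negP neq_ji; rewrite mcoeffZ mcoeffX.
case: eqP => [/mnmP/(_ ord_max)|]; last by rewrite mulr0.
rewrite !mnmDE !mulmnE !mnm1E /= !mul0n !mul1n !add0n => /val_inj eq_ji.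
by case: neq_ji; rewrite eq_ji.
Qed.

Lemma discriminant_universal (R : comNzRingType) (d : nat) :
  discriminant d (universal_form R d) = map_mpoly (intr : int -> R) (discrZ d).
Proof.
rewrite /discriminant /map_mpoly /mmap; apply: eq_bigr => m _ /=.
rewrite -[RHS]/(_ * _) rmorph_int; congr (_ * _).
by rewrite /mmap1; apply: eq_bigr => i _; rewrite mcoeff_universal.
Qed.

(* Main.v *)
(* Write f = g(x^2) + x h(x^2). In characteristic 2, f' = h(x^2), so that the
   resultant of f and f', in formal degrees d and d - 1, is that of g(x^2) and
   h(x^2), i.e. a_0 times the square of the resultant of g and h. The latter is
   the determinant of the Hurwitz matrix of f of size d - 1, whose entries are
   coefficients of f. *)
Require Import Defs.
From HB Require Import structures.
From mathcomp Require Import all_boot all_order all_algebra.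
From mathcomp Require Import perm zify.

Import Order.TTheory GRing.Theory Num.Theory.
Local Open Scope ring_scope.

(** Injective self-maps of the index range are permutations, so only a sign can change. Index maps
    on [nat] leave their side conditions to [lia]. *)
Lemma det_reindex (R : comNzRingType) (N : nat) (a : nat -> nat -> R)
    (f g : nat -> nat) :
  {homo f : i / (i < N)%N} -> {homo g : i / (i < N)%N} ->
  {in gtn N &, injective f} -> {in gtn N &, injective g} ->
  exists b : bool, \det (\matrix_(i < N, j < N) a (f i) (g j)) =
    (-1) ^+ b * \det (\matrix_(i < N, j < N) a i j).
Proof.
move=> ltf ltg injf injg.
pose f' (i : 'I_N) := Ordinal (ltf i (ltn_ord i)).
pose g' (i : 'I_N) := Ordinal (ltg i (ltn_ord i)).
have inj_f' : injective f'.
  by move=> i j [/injf eq_ij]; apply: val_inj; apply: eq_ij; rewrite inE.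
have inj_g' : injective g'.
  by move=> i j [/injg eq_ij]; apply: val_inj; apply: eq_ij; rewrite inE.
pose A := \matrix_(i < N, j < N) a i j.
exists (perm inj_f' (+) perm inj_g').
have -> : \matrix_(i < N, j < N) a (f i) (g j) =
    row_perm (perm inj_f') (col_perm (perm inj_g') A).
  by apply/matrixP => i j; rewrite !mxE !permE.
rewrite row_permE col_permE !det_mulmx !det_perm odd_permV.
by rewrite signr_addb -mulrA [\det A * _]mulrC.
Qed.

(* The guard replaces a negative index, which truncated subtraction would turn
   into 0. *)
Definition hurwitz_mx {R : nzRingType} (m : nat) (f : {poly R}) : 'M[R]_m :=
  \matrix_(i < m, j < m) (f`_(j.*2.+1 - i) *+ (i <= j.*2.+1)%N).

(** Above the corner, the last column holds only coefficients of index at least n + 2, which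
    vanish. *)
Lemma det_hurwitz_last (R : comNzRingType) (n : nat) (f : {poly R}) :
  (size f <= n.+2)%N ->
  \det (hurwitz_mx n.+1 f) = f`_n.+1 * \det (hurwitz_mx n f).
Proof.
move=> size_f; rewrite (expand_det_col _ ord_max) (bigD1 ord_max) //=.
rewrite big1 ?addr0; last first.
  move=> i /eqP neq_i; rewrite mxE nth_default ?mul0rn ?mul0r //=.
  have : (i : nat) <> n by move=> eq_i; apply: neq_i; apply: val_inj.
  have := ltn_ord i => lt_in neq_n; apply: leq_trans size_f _; lia.
have -> : hurwitz_mx n.+1 f ord_max ord_max = f`_n.+1.
  rewrite mxE /=; have -> : (n.*2.+1 - n = n.+1)%N by lia.
  by have -> : (n <= n.*2.+1)%N by lia.
rewrite /cofactor addnn -signr_odd odd_double expr0 mul1r.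
by congr (_ * \det _); apply/matrixP => i j; rewrite !mxE !lift_max.
Qed.

(* Unlike Sylvester_mx p q, the dimension is that of formal degrees n + 1 and n,
   so that it commutes with maps dropping the degree of q. *)
Definition form_sylvester_mx {R : nzRingType} (n : nat) (p q : {poly R}) :
    'M[R]_(n + n.+1) :=
  col_mx (\matrix_(i < n, j < n + n.+1) (p`_(j - i) *+ (i <= j)%N))
         (\matrix_(i < n.+1, j < n + n.+1) (q`_(j - i) *+ (i <= j)%N)).

Lemma mulrn_odd_pchar2 (R : nzRingType) (x : R) (m : nat) :
  2%N \in [pchar R] -> x *+ m = x *+ odd m.
Proof.
move=> char2; rewrite -{1}(odd_double_half m) mulrnDr -mul2n mulrnA.
by rewrite (mulrn_pchar char2) mul0rn addr0.
Qed.

(* Since f' is even, subtracting x * (row i of f') from row i of f leaves only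
   even powers of x in every generator. The even and odd columns then decouple
   into Hurwitz matrices of sizes n + 1 and n. *)
Lemma det_form_sylvester_deriv (R : comNzRingType) (n : nat) (f : {poly R}) :
  2%N \in [pchar R] -> (size f <= n.+2)%N ->
  \det (form_sylvester_mx n f f^`()) = f`_n.+1 * \det (hurwitz_mx n f) ^+ 2.
Proof.
move=> char2 size_f.
(* The matrix after elimination: the first [n] rows are shifts of g(x^2), the others shifts of f' =
   h(x^2). *)
pose a (i j : nat) : R :=
  if (i < n)%N then f`_(j - i) *+ ((i <= j)%N && ~~ odd (j - i))
  else f`_(j - (i - n)).+1 *+ ((i - n <= j)%N && ~~ odd (j - (i - n))).
have -> : \det (form_sylvester_mx n f f^`()) =
    \det (\matrix_(i < n + n.+1, j < n + n.+1) a i j).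
  (* T replaces row x^i f by x^i f - x^(i+1) f'. *)
  pose T : 'M[R]_(n + n.+1) :=
    block_mx 1%:M (\matrix_(i, j) - ((j == i.+1 :> nat)%:R)) 0 1%:M.
  have det_T : \det T = 1 by rewrite det_ublock !det1 mulr1.
  rewrite -[LHS]mul1r -det_T -det_mulmx; congr (\det _).
  rewrite /T /form_sylvester_mx mul_block_col !mul1mx mul0mx add0r.
  apply/matrixP => i j; rewrite !mxE; case: splitP => k eq_i; rewrite !mxE /a eq_i.
    have lt_k : (k.+1 < n.+1)%N by rewrite ltnS.
    rewrite ltn_ord (bigD1 (Ordinal lt_k)) //= big1 ?addr0; last first.
      by move=> l; rewrite -val_eqE /= !mxE => /negPf->; rewrite oppr0 mul0r.
    rewrite !mxE eqxx coef_deriv mulN1r /=.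
    case: (ltngtP k j) => [lt_kj|lt_jk|eq_kj]; last first.
    - by rewrite eq_kj subnn mulr0n subr0.
    - by rewrite mulr0n subr0.
    (* The entry is f_(j-k) minus j - k times itself: in characteristic 2 it vanishes for j - k odd
       and stays f_(j-k) for j - k even. *)
    have -> : ((j - k.+1).+1 = j - k)%N by lia.
    rewrite !mulr1n (mulrn_odd_pchar2 _ _ (j - k) char2).
    by case: (odd _); rewrite ?subrr ?subr0.
  have -> : (n + k < n)%N = false by lia.
  rewrite coef_deriv (mulrn_odd_pchar2 _ _ _.+1 char2) addKn -mulrnA mulnC mulnb.
  by [].
have a_low i j : (i < n)%N ->
    a i j = f`_(j - i) *+ ((i <= j)%N && ~~ odd (j - i)) by rewrite /a => ->.
have a_high i j : a (n + i)%N j = f`_(j - i).+1 *+ ((i <= j)%N && ~~ odd (j - i)).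
  by rewrite /a addKn ltnNge leq_addr.
have coef_eq x y (b1 b2 : bool) : b1 = b2 -> (b2 -> x = y) ->
    f`_x *+ b1 = f`_y *+ b2.
  by move=> ->; case: b2 => [/(_ isT)->|].
have coef_0 x (b : bool) : ~~ b -> f`_x *+ b = 0 by case: b.
(* In the order r the rows x^j f' with j even and those of f with i even come
   first; c lists the even columns first. *)
pose r t := (if t <= n then if odd t then t.-1 else n + t
  else if odd (t - n.+1) then t - n.+1 else n + (t - n.+1).+1)%N.
pose c t := (if t <= n then t.*2 else (t - n.+1).*2.+1)%N.
have r_low t : (t < n.+1)%N -> r t = (if odd t then t.-1 else n + t)%N.
  by rewrite /r ltnS => ->.
have r_high t : r (n.+1 + t)%N = (if odd t then t else n + t.+1)%N.
  by rewrite /r addKn leqNgt ltnS leq_addr.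
have c_low t : (t < n.+1)%N -> c t = t.*2 by rewrite /c ltnS => ->.
have c_high t : c (n.+1 + t)%N = t.*2.+1.
  by rewrite /c addKn leqNgt ltnS leq_addr.
have [|||| b eq_det] := det_reindex R (n + n.+1) a r c.
- by move=> t; rewrite /r; do !case: ifP; lia.
- by move=> t; rewrite /c; do !case: ifP; lia.
- by move=> t u; rewrite !inE /r; do !case: ifP; lia.
- by move=> t u; rewrite !inE /c; do !case: ifP; lia.
have sign1 : (-1) ^+ b = 1 :> R by case: b {eq_det}; rewrite ?(oppr_pchar2 char2).
rewrite sign1 mul1r in eq_det; rewrite -eq_det (addnC n n.+1).
(* In a diagonal block, row s and column t give f_(2t+1-s) for either kind of row. Outside these
   blocks the shift and the column have opposite parity, so the entry is 0. *)
suff -> : \matrix_(i < n.+1 + n, j < n.+1 + n) a (r i) (c j) =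
    block_mx (hurwitz_mx n.+1 f) 0 0 (hurwitz_mx n f).
  by rewrite det_ublock det_hurwitz_last // -mulrA.
apply/matrixP => i j; rewrite !mxE; case: splitP => s eq_i; rewrite !mxE;
  case: splitP => t eq_j; rewrite !mxE eq_i eq_j.
all: have lt_s := ltn_ord s; have lt_t := ltn_ord t.
all: rewrite ?r_high ?c_high ?r_low ?c_low //.
all: case: ifP => odd_s; rewrite ?a_high ?a_low; try lia.
all: first [by apply: coef_eq; lia | by apply: coef_0; lia].
Qed.

(** The sizes are prescribed over [A] only: applying [phi] entrywise keeps the dimension of the
    matrix even if a degree drops over [B]. *)
Lemma map_resultant_deriv (A B : comNzRingType) (phi : {rmorphism A -> B})
    (n : nat) (p : {poly A}) :
  size p = n.+2 -> size p^`() = n.+1 ->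
  phi (resultant p p^`()) =
    \det (form_sylvester_mx n (map_poly phi p) (map_poly phi p)^`()).
Proof.
rewrite deriv_map; move: p^`() => q size_p size_q.
rewrite /resultant -det_map_mx.
have E i j : map_mx phi (Sylvester_mx p q) i j =
    match split i with
    | inl l => phi p`_(j - l) *+ (l <= j)%N
    | inr l => phi q`_(j - l) *+ (l <= j)%N
    end.
  by rewrite mxE Sylvester_mxE; case: split => l; rewrite rmorphMn.
(* The dimension depends on the sizes, so the matrix is abstracted, keeping only its entries, before
   they are rewritten. *)
move: (map_mx _ _) E; rewrite size_p size_q /= => S E; congr (\det _).
apply/matrixP => i j; rewrite E [RHS]mxE.
by case: split => l; rewrite mxE coef_map.
Qed.

Lemma size_dehomogenize_universal (R : comNzRingType) (d : nat) :
  size (dehomogenize (universal_form R d)) = d.+1.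
Proof.
apply/eqP; rewrite eqn_leq; apply/andP; split.
  apply/leq_sizeP => n lt_dn.
  by rewrite coef_dehomogenize_universal leqNgt lt_dn.
rewrite ltnNge; apply/negP => /leq_sizeP/(_ d (leqnn _)).
rewrite coef_dehomogenize_universal leqnn.
move=> /(congr1 (mcoeff U_(inord (d - d)))); rewrite mcoeffXU eqxx mcoeff0.
by apply/eqP; exact: oner_neq0.
Qed.

(** For d > 0 the leading coefficient is d times a_0, nonzero over the integers; in characteristic 2
    it vanishes for even d. *)
Lemma size_deriv_dehomogenize_universal (d : nat) :
  size (dehomogenize (universal_form int d))^`() = d.
Proof.
apply/eqP; rewrite eqn_leq; apply/andP; split.
  apply/leq_sizeP => n le_dn.
  by rewrite coef_deriv coef_dehomogenize_universal ltnNge le_dn mul0rn.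
case: d => [|d] //; rewrite ltnNge; apply/negP => /leq_sizeP/(_ d (leqnn _)).
rewrite coef_deriv coef_dehomogenize_universal leqnn.
move=> /(congr1 (mcoeff U_(inord (d.+1 - d.+1)))).
by rewrite mcoeffMn mcoeffXU eqxx mcoeff0 => /eqP; rewrite pnatr_eq0.
Qed.

Lemma dhomog_det (R : comNzRingType) (n m : nat) (M : 'M[{mpoly R[n]}]_m) :
  (forall i j, M i j \is 1.-homog) -> \det M \is m.-homog.
Proof.
move=> homM; apply: rpred_sum => s _; rewrite rpredMsign.
suff: \prod_(i < m) M i (s i) \is (\sum_(i < m) 1)%N.-homog.
  by rewrite sum1_card card_ord.
apply: (big_ind2 (fun p e => p \is e.-homog)) => [|p d q e|i _].
- exact: dhomog1.
- exact: dhomogM.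
- exact: homM.
Qed.

Theorem proposition5p3 (k : fieldType) (char2 : 2%N \in [pchar k])
    (d : nat) (d_gt0 : (0 < d)%N) :
  exists q : {mpoly k[d.+1]},
    (q \is d.-1.-homog) /\ discriminant d (universal_form k d) = q ^+ 2.
Proof.
case: d d_gt0 => [//|n] d_gt0.
have char2K : 2%N \in [pchar {mpoly k[n.+2]}].
  exact: (@rmorph_pchar k {mpoly k[n.+2]} (mpolyC n.+2 (R:=k)) 2 char2).
set f := dehomogenize (universal_form k n.+1).
exists (\det (hurwitz_mx n f)); split.
  (* Each entry is a variable or 0, and 0 is homogeneous of every degree. *)
  apply: dhomog_det => i j; rewrite mxE rpredMn // coef_dehomogenize_universal.
  by case: ifP => _; rewrite ?rpred0 // dhomogX /= mdeg1.
have X_neq0 : ('X_ord0 : {mpoly k[n.+2]}) != 0.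
  apply/eqP=> /(congr1 (mcoeff U_(ord0))).
  by rewrite mcoeffXU eqxx mcoeff0; apply/eqP; exact: oner_neq0.
pose phi : {rmorphism {mpoly int[n.+2]} -> {mpoly k[n.+2]}} :=
  map_mpoly (intr : int -> k).
have phiX i : phi 'X_i = 'X_i by rewrite /phi /= map_mpolyX.
have phi_f : map_poly phi (dehomogenize (universal_form int n.+1)) = f.
  apply/polyP => i; rewrite coef_map !coef_dehomogenize_universal.
  by case: ifP => _; [exact: phiX | exact: (rmorph0 phi)].
(* Multiplying by a_0 undoes the division in [discrZ], leaving the image under [phi] of an integral
   resultant. *)
rewrite discriminant_universal; apply: (mulfI X_neq0).
rewrite -[LHS]/(_ * phi _) -{1}phiX -rmorphM discrZE // rmorphM rmorphXn rmorphN1.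
rewrite (oppr_pchar2 char2K) expr1n mul1r (map_resultant_deriv _ _ _ n).
- rewrite phi_f (det_form_sylvester_deriv _ _ _ char2K) ?size_dehomogenize_universal //.
  rewrite coef_dehomogenize_universal leqnn subnn; congr ('X_ _ * _).
  by apply: val_inj; rewrite /= inordK.
- exact: size_dehomogenize_universal.
- exact: size_deriv_dehomogenize_universal.
Qed.
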